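(* Suppose $n\ge3$. For any $\mathsf x\in\mathfrak{gl}_n(\mathbb C)$ the scheme $\mathcal B(\mathsf x,H(\mathbf m_{\mathbf{max}}))\subseteq GL_n(\mathbb C)/B$ is reduced.
   Context: $B$ is the subgroup of upper triangular matrices in $G=GL_n(\mathbb C)$. $\mathbf m_{\mathbf{max}}=(n-1,n,\dots,n)$ (length $n$), and $H(\mathbf m_{\mathbf{max}})$ is the space of matrices $\mathsf a\in\mathfrak{gl}_n(\mathbb C)$ with $\mathsf a_{n1}=0$. As a set, $\mathcal B(\mathsf x,H(\mathbf m_{\mathbf{max}}))=\{gB\in G/B\mid g^{-1}\mathsf xg\in H(\mathbf m_{\mathbf{max}})\}$. Scheme structure: $\mathcal B(\mathsf x,H(\mathbf m_{\mathbf{max}}))$ is the closed subscheme of $G/B$ whose pullback to $G$ is the ($B$-stable) closed subscheme defined by the vanishing of the regular function $g\mapsto(g^{-1}\mathsf xg)_{n1}$. Equivalently, let $U_-\cong\mathbb C^{\binom n2}$ be the group of lower triangular matrices with $1$'s on the diagonal, with coordinates $z_{ji}$ ($1\le i<j\le n$), and for $g\in G$ identify the open subset $gU_-B/B$ of $G/B$ with $U_-$ via $u\mapsto guB$. On this open subset, the scheme is defined by the ideal of $\mathbb C[z_{ji}\mid 1\le i<j\le n]$ generated by the polynomial $((gu)^{-1}\mathsf x(gu))_{n1}$, or equivalently (up to a nonzero scalar) by $\det[\mathsf xgu_1\,|\,gu_1\,|\cdots|\,gu_{n-1}]$, where $u_i=e_i+\sum_{j=i+1}^nz_{ji}e_j$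 is the $i$-th column of the generic element $u$ of $U_-$. *)

(* Defs.v *)
From HB Require Import structures.
From mathcomp Require Import all_boot all_order all_algebra.
From mathcomp Require Import mpoly.
From mathcomp Require Import reals complex.

Set Implicit Arguments.
Unset Strict Implicit.
Unset Printing Implicit Defensive.

Import GRing.Theory.
Local Open Scope ring_scope.

Section LocalRings.
Variable A : comNzRingType.

Definition principal_ideal (f : A) : A -> Prop := fun p => exists q, p = q * f.

Record prime_ideal (P : A -> Prop) : Prop := PrimeIdeal {
  prime_ideal0 : P 0;
  prime_idealD : forall a b, P a -> P b -> P (a + b);
  prime_idealM : forall a b, P b -> P (a * b);
  prime_ideal1 : ~ P 1;
  prime_idealP : forall a b, P (a * b) -> P a \/ P b
}.

(* The local ring (A / I)_P is represented by the fractions p / s with s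
   outside P; [local_eq I P (p, s) (q, t)] says that p / s = q / t in it. *)
Definition local_eq (I P : A -> Prop) (x y : A * A) : Prop :=
  exists w, ~ P w /\ I (w * (x.1 * y.2 - y.1 * x.2)).

Definition local_ring_reduced (I P : A -> Prop) : Prop :=
  forall (p s : A) (k : nat), ~ P s ->
    local_eq I P (p ^+ k, s ^+ k) (0, 1) -> local_eq I P (p, s) (0, 1).

End LocalRings.

(* Rows and columns are indexed from 0, so the pair (j, i) with i < j stands
   for the coordinate z_{j+1,i+1}. *)
Definition lower_pairs (n : nat) := {ji : 'I_n * 'I_n | (ji.2 < ji.1)%N}.

(* {mpoly C[n]} has variables indexed by 'I_n, whence the cardinal. *)
Notation coord_ring C n := {mpoly C[#|{: lower_pairs n}|]}.

Section Hessenberg.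
Variables (C : fieldType) (n : nat).

Definition zvar (ji : lower_pairs n) : coord_ring C n := 'X_(enum_rank ji).

Definition generic_unipotent : 'M[coord_ring C n]_n :=
  \matrix_(j, i) if insub (j, i) is Some ji then zvar ji else (j == i)%:R.

Definition generic_rep (g : 'M[C]_n) : 'M[coord_ring C n]_n :=
  map_mx (@mpolyC _ C) g *m generic_unipotent.

End Hessenberg.

(* The equation of B(x, H(m_max)) on the chart g U_- B / B: the (n, 1) entry of
   (g u)^-1 x (g u), where n = m.+1. *)
Definition hess_eqn (C : fieldType) (m : nat) (x g : 'M[C]_m.+1) :
    coord_ring C m.+1 :=
  (invmx (generic_rep g) *m map_mx (@mpolyC _ C) x *m generic_rep g) ord_max ord0.

Definition hess_ideal (C : fieldType) (m : nat) (x g : 'M[C]_m.+1) :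
    coord_ring C m.+1 -> Prop :=
  principal_ideal (hess_eqn x g).

(* The charts g U_- B / B, for g in GL_n(C), cover G / B, so the points of the
   scheme B(x, H(m_max)) are the primes of the coordinate rings of the charts
   that contain the chart's ideal; the scheme is reduced when its local rings
   at all these points are. *)
Definition hess_scheme_reduced (C : fieldType) (m : nat) (x : 'M[C]_m.+1) :
    Prop :=
  forall g : 'M[C]_m.+1, g \in unitmx ->
  forall P : coord_ring C m.+1 -> Prop, prime_ideal P ->
    (forall p, hess_ideal x g p -> P p) ->
    local_ring_reduced (hess_ideal x g) P.

(* Main.v *)
From HB Require Import structures.
Require Import Defs.
From mathcomp Require Import all_boot all_order all_algebra.
From mathcomp Require Import boolp reals complex.
From mathcomp Require Import mpoly ring zify.

(** Why the scheme is reduced.  On the chart of [g] the equation is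
    [f = M_{n1}], where [M = u^-1 y u], [y = g^-1 x g] and [u] is the generic
    lower unitriangular matrix.  It suffices that the ideal [(f)] is radical.
    If [f = 0] this holds because the coordinate ring is a domain.  If [f] is
    not zero then, polynomial rings over a field being factorial
    ([factorial_mpoly]), it is enough that every [h] with [h^2 | f] is a unit
    ([prime_product_radical], [hess_squarefree]).

    Two one-parameter deformations of the coordinates show this.  In both, the
    degree in the parameter [t] is additive on products, so that a bound on the
    degree of a multiple of [h^2] bounds the degree of [h].

    The first one replaces [u] by [u (1 + t E_{ni})] with [1 < i < n].  It turns
    [f] into [f - t M_{i1}], of degree at most 1 in [t]; so [h] does not move
    and [h^2] also divides [M_{i1}] ([square_dvd_hess_column]).  All the
    entries of the first column of [M] other than the top one are then divisible
    by [h^2]: modulo [h^2] the first column [v] of [u] is an eigenvector of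
    [y].  In other words [h^2] divides each
      [A_k = (y v)_k - v_k (y v)_1]    ([square_dvd_eigen_defect]),
    and not all the [A_k] vanish, since otherwise [f = 0]
    ([eigen_defect0_hess]).

    The second one multiplies every coordinate by [t].  The [A_k] have degree
    at most 2 in [v_2, ..., v_n], because [v_1 = 1]; so [h] has degree at most 1.
    Suppose that it has degree 1, with linear part [h_1].  Then
    [A_k = c_k h^2] with [c_k] a scalar, and comparing the terms of degree 2
    gives [- v_k L = c_k h_1^2], where [L] is the linear part of [(y v)_1].
    As [n >= 3], this can be written for [k = 2] and [k = 3]; eliminating [h_1]
    gives [(c_2 v_3 - c_3 v_2) L = 0].  If [L] were not zero, the independence of
    the two variables would give [c_2 = 0] and then [v_2 L = 0], which is absurd;
    so [L = 0].  Hence every [c_k], and so every [A_k], is zero, a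
    contradiction: [h] is a nonzero constant.  For [n = 2] only one [k] is
    left, and [f] can indeed be a square.

    Factoriality comes from Gauss's lemma ([factorial_ring_poly]), in a form
    that stays in [R[t]]: pseudo-division already gives the arithmetic of
    polynomials over the fraction field, and the primes of [R] that occur in
    the denominators are cancelled one at a time. *)

Set Implicit Arguments.
Unset Strict Implicit.
Unset Printing Implicit Defensive.

Import GRing.Theory.
Local Open Scope ring_scope.

Local Notation "a '%|r' b" := (principal_ideal a b)
  (at level 70, no associativity).

(** * Products of primes in a domain *)

Section PrimeProducts.
Variable A : idomainType.
Implicit Types a b p q u x : A.

Definition prime_elt p := p != 0 /\ prime_ideal (principal_ideal p).

Lemma prime_eltI p : p != 0 -> ~ (p %|r 1) ->
  (forall a b, p %|r a * b -> p %|r a \/ p %|r b) -> prime_elt p.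
Proof.
move=> p0 p1 pP; split=> //; split=> // [|a b|a b].
- by exists 0; rewrite mul0r.
- by move=> [q ->] [r ->]; exists (q + r); rewrite mulrDl.
- by move=> [q ->]; exists (a * q); rewrite mulrA.
Qed.

(** Having a factorization is an inductive predicate, so that cancelling a
    product of primes in an equation is done by induction, one prime at a
    time. *)
Inductive prime_product : A -> Prop :=
| PrimeProductUnit u : u \is a GRing.unit -> prime_product u
| PrimeProductMul p a :
    prime_elt p -> prime_product a -> prime_product (p * a).

Lemma prime_productM a b :
  prime_product a -> prime_product b -> prime_product (a * b).
Proof.
elim=> [u Uu | p c pp _ IH] ppb; last first.
  by rewrite -mulrA; apply: PrimeProductMul => //; apply: IH.
case: b / ppb => [v Uv | p b pp ppb].
  by apply: PrimeProductUnit; rewrite unitrM Uu.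
suff: prime_product (u * b) by rewrite mulrCA; apply: PrimeProductMul.
elim: {p pp} ppb => [v Uv | p c pp _ IH].
  by apply: PrimeProductUnit; rewrite unitrM Uu.
by rewrite mulrCA; apply: PrimeProductMul.
Qed.

(** The radical of a principal ideal is read off the factorization of its
    generator: a prime divides [x] as soon as it divides a power of [x], and
    primes that occur only once in [a] can be divided out in turn. *)
Lemma prime_product_radical a x k :
    prime_product a -> (forall p, prime_elt p -> ~ (p * p %|r a)) ->
  a %|r x ^+ k -> a %|r x.
Proof.
move=> ppa; elim: ppa x => {a} [u Uu x _ _ | p a pp _ IH x sqf [q Eq]].
  by exists (x / u); rewrite divrK.
have [r Er]: a %|r x.
  apply: IH => [p' pp' [s Es]|]; last by exists (q * p); rewrite Eq; ring.
  by apply: (sqf p' pp'); exists (p * s); rewrite Es; ring.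
have [p0 Pp] := pp.
have px : p %|r x.
  have: p %|r x ^+ k by exists (q * a); rewrite Eq; ring.
  elim: k {Eq IH} => [|k IHk]; first by move/(prime_ideal1 Pp).
  by rewrite exprS => /(prime_idealP Pp) [].
have [|[s Es]|[s Es]] := prime_idealP Pp (a := r) (b := a).
- by rewrite -Er.
- by exists s; rewrite Er Es; ring.
- by case: (sqf p pp); exists s; rewrite Es; ring.
Qed.

Definition factorial_ring := forall a, a != 0 -> prime_product a.

End PrimeProducts.

Lemma factorial_ring_iso (A B : idomainType) (f : {rmorphism A -> B})
    (g : {rmorphism B -> A}) :
  cancel f g -> cancel g f -> factorial_ring B -> factorial_ring A.
Proof.
move=> fK gK facB a a0.
have dvd_g p b : (p %|r b) -> (g p %|r g b).
  by case=> q ->; exists (g q); rewrite rmorphM.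
have dvd_f p b : (g p %|r b) -> (p %|r f b).
  by case=> q ->; exists (f q); rewrite rmorphM gK.
have prime_g p : prime_elt p -> prime_elt (g p).
  move=> [p0 [_ _ _ p1 pP]]; apply: prime_eltI => [||x y].
  - by apply: contraNneq p0 => gp0; rewrite -(gK p) gp0 rmorph0.
  - by move/dvd_f; rewrite rmorph1.
  - by move/dvd_f; rewrite rmorphM => /pP [] /dvd_g; rewrite fK; [left|right].
have : prime_product (f a).
  by apply: facB; apply: contraNneq a0 => fa0; rewrite -(fK a) fa0 rmorph0.
rewrite -[X in _ -> prime_product X]fK; elim=> [u Uu | p b pp _ IH].
  by apply: PrimeProductUnit; apply: rmorph_unit.
by rewrite rmorphM; apply: PrimeProductMul => //; apply: prime_g.
Qed.

(** * Gauss's lemma *)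

Section Gauss.
Variable R : idomainType.
Implicit Types (a b c : R) (f g p q : {poly R}).

(** Gauss's lemma proper.  When [a] divides [f * g], look at the constant
    terms of [f] and [g]: [a] divides one of them, which can be removed, and the
    rest of that factor is divisible by ['X] and hence shorter. *)
Lemma prime_elt_polyC a : prime_elt a -> prime_elt a%:P.
Proof.
move=> [a0 [_ _ _ a1 aP]].
have dvdPc f : a%:P %|r f <-> forall i, a %|r f`_i.
  split=> [[q ->] i | dv]; first by exists q`_i; rewrite coefMC.
  exists (\poly_(i < size f) projT1 (cid (dv i))); apply/polyP=> i.
  rewrite coefMC coef_poly; case: ltnP => [_|le_f].
    by case: (cid _).
  by rewrite mul0r nth_default.
apply: prime_eltI => [||f g]; first by rewrite polyC_eq0.
  by move/dvdPc/(_ 0); rewrite coefC.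
elim/poly_ind: f g => [g _|f c IHf g fg]; first by left; exists 0; rewrite mul0r.
have dvdX h : (a%:P %|r h * 'X) -> (a%:P %|r h).
  by move/dvdPc=> dv; apply/dvdPc=> i; have := dv i.+1; rewrite coefMX.
have dvdD (h k : {poly R}) : (a%:P %|r h + k) -> (a%:P %|r k) -> (a%:P %|r h).
  by move=> [q Eq] [r Er]; exists (q - r); rewrite mulrBl -Eq -Er addrK.
have [[d Ed] | ndc] := EM (a %|r c).
  have Ec : a%:P %|r c%:P by exists d%:P; rewrite Ed polyCM.
  have : a%:P %|r f * g.
    apply: dvdX; apply: (dvdD _ (c%:P * g)).
      by case: fg => q Eq; exists q; rewrite -Eq; ring.
    by case: Ec => q ->; exists (q * g); ring.
  case/IHf=> [[q ->]|]; last by right.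
  by left; exists (q * 'X + d%:P); rewrite Ed polyCM; ring.
right; elim/poly_ind: g fg => [_|g d IHg fg]; first by exists 0; rewrite mul0r.
have [|//|[e Ee]] := aP c d.
  by move/dvdPc/(_ 0): fg; rewrite coef0M !coefD !coefMX !coefC !add0r.
have [|q ->] := IHg.
  apply: dvdX; apply: (dvdD _ ((f * 'X + c%:P) * d%:P)).
    by case: fg => q Eq; exists q; rewrite -Eq; ring.
  by exists ((f * 'X + c%:P) * e%:P); rewrite Ee polyCM; ring.
by exists (q * 'X + e%:P); rewrite Ee polyCM; ring.
Qed.

(** The constant [b] is a nonzerodivisor modulo [f]: the property of the leading
    coefficient of [f] that turns pseudo-divisibility by [f] into
    divisibility. *)
Definition dvdp_regular b f := forall p r, b%:P * p = r * f -> f %|r p.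

Lemma prime_product_polyC a : prime_product a -> prime_product a%:P.
Proof.
elim=> [u Uu | p b pp _ IH].
  by apply: PrimeProductUnit; apply: (rmorph_unit polyC).
by rewrite polyCM; apply: PrimeProductMul => //; apply: prime_elt_polyC.
Qed.

(** [irreducible_poly] and [%|] ignore the constants of [R]: they are
    irreducibility and divisibility over its fraction field, where Euclid's lemma
    is available.  The powers of [lead_coef f] by which pseudo-division
    multiplies are cancelled by regularity. *)
Lemma irreducible_regular_prime f :
  irreducible_poly f -> dvdp_regular (lead_coef f) f -> prime_elt f.
Proof.
move=> irr_f reg; have f0 := irredp_neq0 irr_f.
have dvdE p : (f %| p) -> f %|r p.
  move=> dv; have := Pdiv.Idomain.divp_eq p f.
  rewrite (eqP dv) addr0; move: (p %/ f) (scalp p f) => q k {dv}.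
  elim: k q => [|k IHk] q; first by rewrite expr0 scale1r => ->; exists q.
  rewrite exprS -scalerA -mul_polyC => /reg[r /IHk]; exact.
apply: prime_eltI => // [|p q].
  move=> [q E1]; have : f %| 1 by rewrite E1 dvdp_mull.
  by rewrite dvdp1 => /eqP E; have := irr_f.1; rewrite E.
move=> [r Er]; case fp : (f %| p); first by left; apply: dvdE.
right; apply: dvdE; have := irreducible_poly_coprime p irr_f.
by rewrite fp => /Pdiv.Idomain.Gauss_dvdpr <-; rewrite Er dvdp_mull.
Qed.

(** The primes of [lead_coef f] are treated one after the other: such a prime
    either divides [f], and is split off, or is regular modulo [f] by Gauss's
    lemma.  At the end the leading coefficient of what remains is regular. *)
Lemma irreducible_prime_product f : prime_product (lead_coef f) ->
  irreducible_poly f -> prime_product f.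
Proof.
move Ea: (lead_coef f) => a ppa irr_f.
have reg1 : dvdp_regular 1 f by move=> p r; rewrite mul1r => ->; exists r.
have lcf : lead_coef f = a * 1 by rewrite mulr1.
(* [b] collects the primes already known to be regular modulo [f]. *)
move: (1 : R) lcf reg1 => b {Ea}.
elim: ppa f irr_f b => {a} [u Uu | p a pp _ IH] f irr_f b lcf reg.
  rewrite -[f]mulr1; apply: PrimeProductMul; last first.
    by apply: PrimeProductUnit; rewrite unitr1.
  apply: irreducible_regular_prime => // p r; rewrite lcf polyCM -mulrA => E.
  apply: (reg p (u^-1%:P * r)).
  by rewrite -[RHS]mulrA -E mulrA -polyCM mulVr ?polyC1 ?mul1r.
have pPp := prime_elt_polyC pp; have [p0 Pp] := pPp.
have [[g Eg] | npf] := EM (p%:P %|r f).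
  rewrite Eg mulrC; apply: PrimeProductMul => //.
  have p0' : p != 0 by rewrite -polyC_eq0.
  apply: (IH g _ b).
  - have Ef : f = p *: g by rewrite Eg mulrC mul_polyC.
    have eqfg : f %= g by rewrite Ef eqp_scale.
    split; first by rewrite -(size_scale g p0') -Ef irr_f.1.
    move=> q q1; rewrite -(eqp_dvdr _ eqfg) => /(irr_f.2 q q1) /eqp_trans; exact.
  - apply: (mulfI p0'); rewrite !mulrA -lcf Eg lead_coefM lead_coefC; ring.
  move=> q r E; have [s Es] : f %|r p%:P * q.
    by apply: (reg _ r); rewrite Eg [RHS]mulrA -E; ring.
  by exists s; apply: (mulfI p0); rewrite Es Eg; ring.
apply: (IH f irr_f (p * b)); first by rewrite lcf; ring.
move=> q r; rewrite polyCM -mulrA => E.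
have [|[s Es]|//] := prime_idealP Pp (a := r) (b := f).
  by exists (b%:P * q); rewrite -E mulrC.
by apply: (reg q s); apply: (mulfI p0); rewrite E Es; ring.
Qed.

(** A factorization over the fraction field descends to [R[t]]: each prime of
    the denominator divides one of the two factors. *)
Lemma cancel_prime_product c f g h : prime_product c -> c *: f = g * h ->
  exists g' h', [/\ f = g' * h', size g' = size g & size h' = size h].
Proof.
move=> ppc; elim: ppc g h => {c} [u Uu | p c pp _ IH] g h.
  have u0 : u != 0 by apply: contraTneq Uu => ->; rewrite unitr0.
  move=> E; exists (u^-1 *: g), h.
  split=> //; last by rewrite size_scale ?invr_neq0.
  by rewrite -scalerAl -E scalerA mulVr ?scale1r.
move=> E; have p0 := pp.1; have [P0 Pp] := prime_elt_polyC pp.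
have E' : p%:P * (c *: f) = g * h by rewrite -E -scalerA mul_polyC.
have [|[q Eq]|[q Eq]] := prime_idealP Pp (a := g) (b := h).
- by exists (c *: f); rewrite -E' mulrC.
- have [|g' [h' [Ef sg sh]]] := IH q h.
    by apply: (mulfI P0); rewrite E' Eq; ring.
  by exists g', h'; rewrite Ef sg sh Eq [q * _]mulrC mul_polyC size_scale.
- have [|g' [h' [Ef sg sh]]] := IH g q.
    by apply: (mulfI P0); rewrite E' Eq; ring.
  by exists g', h'; rewrite Ef sg sh Eq [q * _]mulrC mul_polyC size_scale.
Qed.

Theorem factorial_ring_poly : factorial_ring R -> factorial_ring {poly R}.
Proof.
move=> facR f; move: {2}(size f) (leqnn (size f)) => n.
elim: n f => [|n IH] f; first by rewrite size_poly_leq0 => /eqP-> /eqP.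
move=> le_f f0; have [le1 | gt1] := leqP (size f) 1.
  have /size_poly1P [c c0 ->] : size f == 1 by rewrite eqn_leq le1 size_poly_gt0.
  by apply: prime_product_polyC; apply: facR.
have [irr_f | red_f] := EM (irreducible_poly f).
  by apply: irreducible_prime_product => //; apply: facR; rewrite lead_coef_eq0.
have [g [g1 gf ngf]] : exists g, [/\ size g != 1, g %| f & ~~ (g %= f)].
  apply: contrapT => nog; apply: red_f; split=> // g g1 gf.
  by apply: contrapT => /negP ngf; apply: nog; exists g.
have /Pdiv.Idomain.dvdpP [[c h] /= c0 Ef] := gf.
have [g' [h' [Ef' sg _]]] :=
  cancel_prime_product (facR c c0) (etrans Ef (mulrC _ _)).
have [g0 h0] : g' != 0 /\ h' != 0 by move: f0; rewrite Ef' mulf_eq0 => /norP.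
have lt_g : (size g' < size f)%N.
  rewrite sg ltn_neqAle (dvdp_leq f0 gf) andbT.
  by rewrite (Pdiv.Idomain.dvdp_size_eqp gf).
have lt_h : (size h' < size f)%N.
  have : (1 < size g')%N by rewrite sg ltn_neqAle eq_sym g1 -sg size_poly_gt0.
  rewrite Ef' size_mul //; case: (size g') => [|[|k]] // _.
  by rewrite !addSn /= ltnS leq_addl.
rewrite Ef'; apply: prime_productM; apply: IH => //.
  by rewrite -ltnS (leq_trans lt_g).
by rewrite -ltnS (leq_trans lt_h).
Qed.

End Gauss.

(** * Polynomial rings over a field are factorial *)

Lemma mpoly_rmorph_ext n (K : comNzRingType) (S : nzRingType)
    (f g : {rmorphism {mpoly K[n]} -> S}) :
  (forall c, f c%:MP = g c%:MP) -> (forall i, f 'X_i = g 'X_i) -> f =1 g.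
Proof.
move=> eqC eqX p; rewrite (mpolyE p) !rmorph_sum; apply: eq_bigr => m _.
rewrite -mul_mpolyC !rmorphM /= eqC mpolyXE_id !rmorph_prod; congr (_ * _).
by apply: eq_bigr => i _; rewrite !rmorphXn eqX.
Qed.

Lemma mpolyC_unit n (K : fieldType) (c : K) :
  c != 0 -> (c%:MP : {mpoly K[n]}) \is a GRing.unit.
Proof. by move=> c0; apply: (rmorph_unit (@mpolyC n K)); rewrite unitfE. Qed.

Section FactorialMpoly.
Variable K : fieldType.

Lemma muniXwiden n (i : 'I_n) :
  muni ('X_(widen_ord (leqnSn n) i) : {mpoly K[n.+1]}) = ('X_i)%:P.
Proof.
rewrite muniE msuppX big_seq1 mcoeffX eqxx scale1r mnmE.
rewrite -val_eqE /= ltn_eqF ?ltn_ord // expr0 -mul_polyC mulr1.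
by congr ('X_[_])%:P; apply/mnmP => j; rewrite !mnmE -val_eqE.
Qed.

Lemma muniXmax n : muni ('X_ord_max : {mpoly K[n.+1]}) = 'X.
Proof.
rewrite muniE msuppX big_seq1 mcoeffX eqxx scale1r mnmE eqxx expr1.
rewrite -[RHS]scale1r -mpolyX0; congr ('X_[_] *: _); apply/mnmP => j.
by rewrite !mnmE -val_eqE /= gtn_eqF ?ltn_ord.
Qed.

Definition muni_inv n : {poly {mpoly K[n]}} -> {mpoly K[n.+1]} :=
  horner_eval 'X_ord_max \o map_poly (@mwiden n K).

HB.instance Definition _ n := GRing.RMorphism.on (@muni_inv n).

Lemma muni_invC n p : muni_inv (p%:P : {poly {mpoly K[n]}}) = mwiden p.
Proof. by rewrite /muni_inv /= map_polyC /horner_eval hornerC. Qed.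

Lemma muni_invX n : muni_inv ('X : {poly {mpoly K[n]}}) = 'X_ord_max.
Proof. by rewrite /muni_inv /= map_polyX /horner_eval hornerX. Qed.

Lemma mwidenXU n (i : 'I_n) :
  mwiden ('X_i : {mpoly K[n]}) = 'X_(widen_ord (leqnSn n) i).
Proof. by rewrite mwidenX mnmwiden1. Qed.

Lemma muniK n : cancel (@muni n K) (@muni_inv n).
Proof.
move=> p; apply: (mpoly_rmorph_ext (f := @muni_inv n \o @muni n K) (g := idfun)).
  by move=> c /=; rewrite muniC muni_invC mwidenC.
move=> i /=; have [j Ej | Ei] := unliftP ord_max i.
  have -> : i = widen_ord (leqnSn n) j.
    by apply: val_inj; rewrite Ej /= /bump leqNgt ltn_ord.
  by rewrite muniXwiden muni_invC mwidenXU.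
by rewrite Ei muniXmax muni_invX.
Qed.

Lemma muni_invK n : cancel (@muni_inv n) (@muni n K).
Proof.
have eqC (c : {mpoly K[n]}) : muni (mwiden c) = c%:P.
  apply: (mpoly_rmorph_ext (f := @muni n K \o @mwiden n K) (g := polyC)).
    by move=> d /=; rewrite mwidenC muniC.
  by move=> i /=; rewrite mwidenXU muniXwiden.
elim/poly_ind=> [|p c IH]; first by rewrite !rmorph0.
by rewrite !rmorphD !rmorphM /= muni_invX muniXmax muni_invC IH eqC.
Qed.

Theorem factorial_mpoly n : factorial_ring {mpoly K[n]}.
Proof.
elim: n => [|n IH]; last first.
  exact: factorial_ring_iso (@muniK n) (@muni_invK n) (factorial_ring_poly IH).
move=> p p0; apply: PrimeProductUnit.
have Ep : p = (p@_0)%:MP.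
  apply/mpolyP => m; rewrite mcoeffC; have -> : m = 0%MM.
    by apply/mnmP; case.
  by rewrite eqxx mulr1.
rewrite Ep; apply: mpolyC_unit.
by apply: contraNneq p0 => E; rewrite Ep E mpolyC0.
Qed.

End FactorialMpoly.

(** * Square factors of polynomials of small degree *)

Lemma size_mul_square (A : idomainType) (f q h : {poly A}) :
  f != 0 -> f = q * (h * h) -> (size f).+2 = (size q + (size h).*2)%N.
Proof.
move=> f0 Ef; have [q0 h0] : q != 0 /\ h != 0.
  by split; apply: contraNneq f0 => E; rewrite Ef E ?mul0r ?mulr0.
rewrite Ef !size_mul ?mulf_neq0 //.
have : (0 < size q)%N by rewrite size_poly_gt0.
have : (0 < size h)%N by rewrite size_poly_gt0.
lia.
Qed.

Lemma size_square_factor (A : idomainType) (f q h : {poly A}) d :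
  f != 0 -> f = q * (h * h) -> (size f <= d)%N -> (size h <= uphalf d)%N.
Proof.
move=> f0 Ef; have q0 : q != 0 by apply: contraNneq f0 => E; rewrite Ef E mul0r.
have := size_mul_square f0 Ef; rewrite -size_poly_gt0 in q0; lia.
Qed.

(** The case [f = 0] is included: then [q = 0]. *)
Lemma square_factor_coef2 (A : idomainType) (f q h : {poly A}) :
    f = q * (h * h) -> (size f <= 3)%N -> size h = 2 ->
  (size q <= 1)%N /\ f`_2 = q`_0 * (lead_coef h * lead_coef h).
Proof.
move=> Ef le_f sh; have h0 : h != 0 by rewrite -size_poly_gt0 sh.
have sq : (size q <= 1)%N.
  have [f0 | f0] := eqVneq f 0; last first.
    by have := size_mul_square f0 Ef; rewrite sh; lia.
  move/eqP: Ef; rewrite f0 eq_sym mulf_eq0 mulf_eq0 orbb (negbTE h0) orbF.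
  by move/eqP->; rewrite size_poly0.
split=> //; rewrite {1}Ef (size1_polyC sq) coefCM coefC -lead_coefM; congr (_ * _).
by rewrite lead_coefE size_mul // sh.
Qed.

Lemma size_quadratic (A : nzRingType) (a b c : A) :
  (size (a%:P + b%:P * 'X - c%:P * 'X^2)%R <= 3)%N.
Proof.
apply/leq_sizeP => j le3j; rewrite coefB coefD coefC coefMX coefMXn !coefC.
by case: j le3j => [|[|[|j]]] //= _; rewrite addr0 subr0.
Qed.

Lemma coef2_quadratic (A : nzRingType) (a b c : A) :
  (a%:P + b%:P * 'X - c%:P * 'X^2)`_2 = - c.
Proof. by rewrite coefB coefD coefC coefMX coefMXn !coefC /= add0r sub0r. Qed.

(** Eliminates [s] between the two equations; multiplying by [l * s] rather
    than dividing keeps it a ring identity. *)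
Lemma cross_eq (A : comNzRingType) (x1 x2 c1 c2 l s : A) :
  - (x1 * l) = c1 * s -> - (x2 * l) = c2 * s ->
  c1 * x2 * (l * s) = c2 * x1 * (l * s).
Proof.
move=> E1 E2; transitivity (c1 * s * (x2 * l)); first by ring.
rewrite -E1; transitivity (- (x2 * l) * (x1 * l)); first by ring.
by rewrite E2; ring.
Qed.

(** * Deformations of the coordinates of a chart *)

Section Chart.
Variables (C : fieldType) (m : nat).
Local Notation n := m.+1.
Local Notation A := (coord_ring C n).
Local Notation U := (generic_unipotent C n).

(** A one-parameter family of substitutions; the parameter is the variable ['X]
    of the target, whose degree is additive on products. *)
Definition deform (h : lower_pairs n -> {poly A}) : A -> {poly A} :=
  mmap (polyC \o @mpolyC _ C) (fun k => h (enum_val k)).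

HB.instance Definition _ h := GRing.RMorphism.on (deform h).

Lemma deformC h c : deform h c%:MP = (c%:MP)%:P.
Proof. exact: mmapC. Qed.

Lemma deformX h k : deform h 'X_k = h (enum_val k).
Proof. by rewrite /deform mmapX mmap1U. Qed.

Lemma deform_zvar h ji : deform h (zvar C ji) = h ji.
Proof. by rewrite deformX enum_rankK. Qed.

Lemma deform_id h a p :
  (forall ji, (h ji).[a] = zvar C ji) -> (deform h p).[a] = p.
Proof.
move=> ha; apply: (mpoly_rmorph_ext (f := horner_eval a \o deform h) (g := idfun)).
  by move=> c /=; rewrite deformC /horner_eval hornerC.
by move=> k /=; rewrite deformX /horner_eval ha /zvar enum_valK.
Qed.

Lemma deform0 h a p : (forall ji, (h ji).[a] = 0) ->
  (deform h p).[a] = (p.@[fun=> 0])%:MP.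
Proof.
move=> ha; apply: (mpoly_rmorph_ext (f := horner_eval a \o deform h)
  (g := @mpolyC _ C \o meval (fun=> 0))).
  by move=> c /=; rewrite deformC /horner_eval hornerC mevalC.
by move=> k /=; rewrite deformX /horner_eval ha mevalXU mpolyC0.
Qed.

Lemma unipotent_lt (j i : 'I_n) : (j <= i)%N -> U j i = (j == i)%:R.
Proof.
by move=> le_ji; rewrite mxE; case: insubP => //= -[? ?] /=; rewrite ltnNge le_ji.
Qed.

Lemma unipotent_gt (j i : 'I_n) (lt_ij : (i < j)%N) :
  U j i = zvar C (exist (fun ji : 'I_n * 'I_n => (ji.2 < ji.1)%N) (j, i) lt_ij).
Proof.
rewrite mxE; case: insubP => /= [u _ Eu | ]; last by rewrite lt_ij.
by congr zvar; apply: val_inj.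
Qed.

Lemma unipotent_unit : U \in unitmx.
Proof.
rewrite unitmxE det_trig; last first.
  apply/is_trig_mxP => i j lt_ij; rewrite unipotent_lt ?(ltnW lt_ij) //.
  by rewrite -val_eqE /= ltn_eqF.
by rewrite big1 ?unitr1 // => i _; rewrite unipotent_lt // eqxx.
Qed.

(** * The equation has no square factor *)

(** [M] is the conjugate [U^-1 Y U]; only the equation below, free of inverses,
    has to be carried along ring morphisms. *)
Section Conjugate.
Variables (Y : 'M[C]_n) (M : 'M[A]_n).
Local Notation Yc := (map_mx (@mpolyC _ C) Y).
Hypothesis UM : U *m M = Yc *m U.

Definition shift (i : 'I_n) (ji : lower_pairs n) : {poly A} :=
  (zvar C ji)%:P + (val ji == (ord_max, i))%:R *: 'X.

(** Column [ord_max] of [U] is the last basis vector, so that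
    [U (1 + 'X E_{max,i})] differs from [U] only in the entry [(ord_max, i)]: the
    shift of a single coordinate is a right multiplication of [U]. *)
Lemma deform_shift_unipotent i : i != ord_max ->
  map_mx (deform (shift i)) U
  = map_mx polyC U *m (1%:M + 'X *: delta_mx ord_max i).
Proof.
move=> ni; rewrite mulmxDr mulmx1 -scalemxAr; apply/matrixP => j k.
rewrite [LHS]mxE [RHS]mxE [X in X + _]mxE [X in _ + X]mxE [X in _ * X]mxE.
rewrite (bigD1 ord_max) //= big1 ?addr0; last first.
  by move=> l /negbTE nl; rewrite [X in _ * X]mxE nl mulr0.
rewrite [X in _ * (X * _)]mxE (unipotent_lt (leq_ord j : (j <= @ord_max m)%N)).
rewrite [X in _ * (_ * X)]mxE eqxx /=.
have [lt_kj | le_jk] := ltnP k j.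
  rewrite (unipotent_gt lt_kj) deform_zvar /shift /= xpair_eqE.
  by case: (j == ord_max); case: (k == i);
    rewrite ?polyC0 ?mul0r ?mulr0 ?mulr1 ?scale0r ?scale1r.
rewrite (unipotent_lt le_jk) !rmorph_nat.
case: (j =P ord_max) => [Ej|_]; last by rewrite mul0r mulr0 addr0.
have -> : (k == i) = false; last by rewrite !mulr0 addr0.
apply: contraNF ni => /eqP <-; rewrite -val_eqE /= eqn_leq leq_ord.
by move: le_jk; rewrite Ej.
Qed.

(** Conjugating [M] by [1 + 'X E_{max,i}] subtracts ['X] times row [i] from the
    last row, and leaves column [0] alone as [i] is not [0]. *)
Lemma deform_shift_hess i : i != ord_max -> i != ord0 ->
  deform (shift i) (M ord_max ord0)
  = (M ord_max ord0)%:P - (M i ord0)%:P * 'X.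
Proof.
move=> ni ni0; set F := map_mx (deform (shift i)) M.
set E : 'M[{poly A}]_n := 1%:M + 'X *: delta_mx ord_max i.
have EM : E *m F = map_mx polyC M *m E.
  have Uu : map_mx polyC U \in unitmx.
    by rewrite unitmxE det_map_mx rmorph_unit // -unitmxE unipotent_unit.
  apply: (can_inj (mulKmx Uu)); rewrite !mulmxA -deform_shift_unipotent //.
  rewrite -map_mxM UM -[in RHS]map_mxM UM !map_mxM -mulmxA.
  rewrite -deform_shift_unipotent //; congr (_ *m _).
  by apply/matrixP => j k; rewrite !mxE /= deformC.
have EMi k : (E *m F) k ord0
    = deform (shift i) (M k ord0)
      + (k == ord_max)%:R * 'X * deform (shift i) (M i ord0).
  rewrite mulmxDl mul1mx -scalemxAl !mxE; congr (_ + _).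
  rewrite (bigD1 i) //= big1 ?addr0 => [|l /negbTE nl]; last first.
    by rewrite mxE nl andbF mul0r.
  by rewrite !mxE eqxx andbT mulrCA mulrA.
have ME k : (map_mx polyC M *m E) k ord0 = (M k ord0)%:P.
  rewrite mulmxDr mulmx1 -scalemxAr !mxE big1 ?mulr0 ?addr0 // => l _.
  by rewrite !mxE [ord0 == i]eq_sym (negbTE ni0) andbF mulr0.
have := ME i; rewrite -EM EMi (negbTE ni) !mul0r addr0 => EMi0.
have := ME ord_max; rewrite -EM EMi eqxx mul1r EMi0 => <-; ring.
Qed.

(** The shifted equation has degree at most 1 in the parameter, so [h] is not
    affected by the shift; the coefficient of degree 1 of the shifted equation
    is then also a multiple of [h * h]. *)
Lemma square_dvd_hess_column h i : M ord_max ord0 != 0 ->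
  h * h %|r M ord_max ord0 -> i != ord0 -> h * h %|r M i ord0.
Proof.
move=> f0 [q Eq] ni0; have [->|ni] := eqVneq i ord_max; first by exists q.
set D := deform (shift i).
have DK p : (D p).[0] = p.
  apply: deform_id => ji; rewrite /shift hornerD hornerC hornerZ hornerX.
  by rewrite mulr0 addr0.
have Df0 : D (M ord_max ord0) != 0.
  by apply: contraNneq f0 => E; rewrite -(DK (M ord_max ord0)) E horner0.
have EDf : D (M ord_max ord0) = D q * (D h * D h) by rewrite Eq /D !rmorphM.
have DfE := deform_shift_hess ni ni0; rewrite -/D in DfE.
have Dh : D h = h%:P.
  have : (size (D h) <= 1)%N.
    apply: (size_square_factor (d := 2) Df0 EDf).
    rewrite DfE; apply/leq_sizeP => -[|[|k]] // _.
    by rewrite coefB coefC coefMX coefC subr0.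
  rewrite -[X in _ -> _ = X%:P](DK h); move: (D h) => p /size1_polyC ->.
  by rewrite hornerC.
exists (- (D q)`_1); have := congr1 (fun p : {poly A} => p`_1) EDf.
rewrite /= DfE Dh -polyCM coefMC coefB coefC coefMX coefC /= sub0r => E.
by rewrite mulNr -E opprK.
Qed.

(** These minors vanish together exactly when the first column of [U], whose
    top entry is 1, is an eigenvector of [Y]. *)
Definition eigen_defect k : A :=
  (Yc *m U) k ord0 - U k ord0 * (Yc *m U) ord0 ord0.

Lemma hess_corner : (Yc *m U) ord0 ord0 = M ord0 ord0.
Proof.
rewrite -UM mxE (bigD1 ord0) //= unipotent_lt // eqxx mul1r big1 ?addr0 // => j.
by rewrite unipotent_lt // eq_sym => /negbTE ->; rewrite mul0r.
Qed.

Lemma eigen_defectE k :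
  eigen_defect k = \sum_(j | j != ord0) U k j * M j ord0.
Proof.
rewrite /eigen_defect hess_corner -UM mxE (bigD1 ord0) //=.
by rewrite [X in X - _]addrC addrK.
Qed.

Lemma square_dvd_eigen_defect h k : M ord_max ord0 != 0 ->
  h * h %|r M ord_max ord0 -> h * h %|r eigen_defect k.
Proof.
move=> f0 dvdf; rewrite eigen_defectE.
apply: (big_ind (fun x => h * h %|r x)) => [|x y [q ->] [r ->]|j j0].
- by exists 0; rewrite mul0r.
- by exists (q + r); rewrite mulrDl.
- have [q ->] := square_dvd_hess_column f0 dvdf j0.
  by exists (U k j * q); exact: mulrA.
Qed.

(** An eigenvector in the first column of [U] makes the first column of
    [U^-1 Y U] a multiple of the first basis vector. *)
Lemma eigen_defect0_hess :
  (forall k, eigen_defect k = 0) -> (0 < m)%N -> M ord_max ord0 = 0.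
Proof.
move=> dz m0; set a := (Yc *m U) ord0 ord0.
have EYU k : (Yc *m U) k ord0 = U k ord0 * a by apply: subr0_eq; apply: dz.
have : (invmx U *m U) ord_max ord0 * a = 0.
  by rewrite mulVmx ?unipotent_unit // mxE -val_eqE /= gtn_eqF // mul0r.
rewrite -[M](mulKmx unipotent_unit) UM => <-.
rewrite [LHS]mxE [X in _ = X * a]mxE mulr_suml; apply: eq_bigr => k _.
by rewrite EYU mulrA.
Qed.

Definition scaling (ji : lower_pairs n) : {poly A} := 'X * (zvar C ji)%:P.

Lemma deform_scaling_column k : k != ord0 ->
  deform scaling (U k ord0) = 'X * (U k ord0)%:P.
Proof.
rewrite -val_eqE /= -lt0n => lt0k.
by rewrite (unipotent_gt (lt0k : (@ord0 m < k)%N)) deform_zvar.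
Qed.

Definition linear_part k : A := \sum_(j | j != ord0) Yc k j * U j ord0.

Lemma deform_scaling_image k : deform scaling ((Yc *m U) k ord0)
  = ((Y k ord0)%:MP)%:P + 'X * (linear_part k)%:P.
Proof.
rewrite mxE (bigD1 ord0) //= unipotent_lt // eqxx mulr1 rmorphD mxE /= deformC.
congr (_ + _); rewrite /linear_part !rmorph_sum mulr_sumr; apply: eq_bigr => j j0.
by rewrite !rmorphM /= deform_scaling_column // mxE deformC mulrCA.
Qed.

Lemma deform_scaling_defect k : k != ord0 ->
  deform scaling (eigen_defect k) = ((Y k ord0)%:MP)%:P
    + (linear_part k - U k ord0 * (Y ord0 ord0)%:MP)%:P * 'X
    - (U k ord0 * linear_part ord0)%:P * 'X^2.
Proof.
move=> k0; rewrite /eigen_defect rmorphB rmorphM /= deform_scaling_column //.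
by rewrite !deform_scaling_image !(polyCB, polyCM) expr2; ring.
Qed.

Lemma size_deform_scaling_defect k : k != ord0 ->
  (size (deform scaling (eigen_defect k)) <= 3)%N.
Proof. by move=> k0; rewrite deform_scaling_defect // size_quadratic. Qed.

Lemma coef2_deform_scaling_defect k : k != ord0 ->
  (deform scaling (eigen_defect k))`_2 = - (U k ord0 * linear_part ord0).
Proof. by move=> k0; rewrite deform_scaling_defect // coef2_quadratic. Qed.

(** Setting the parameter to [1] gives back [h], setting it to [0] gives its
    constant term. *)
Lemma scaling_const h :
  (size (deform scaling h) <= 1)%N -> h = (h.@[fun=> 0])%:MP.
Proof.
have K1 : (deform scaling h).[1] = h.
  by apply: deform_id => ji; rewrite /scaling hornerM hornerX hornerC mul1r.
have K0 : (deform scaling h).[0] = (h.@[fun=> 0])%:MP.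
  by apply: deform0 => ji; rewrite /scaling hornerM hornerX mul0r.
by move/size1_polyC => E; rewrite -K0 -[LHS]K1 E !hornerC.
Qed.

Lemma zvar_indep (u v : lower_pairs n) (c d : C) :
  u != v -> c%:MP * zvar C u = d%:MP * zvar C v -> c = 0.
Proof.
move=> nuv; rewrite /zvar => E.
have := congr1 (fun p : A => p@_U_(enum_rank u)) E.
rewrite /= !mcoeffCM !mcoeffXU eqxx (inj_eq enum_rank_inj) eq_sym (negbTE nuv).
by rewrite mulr1 mulr0.
Qed.

Lemma zvar_neq0 (u : lower_pairs n) : zvar C u != 0.
Proof.
apply/eqP => /(congr1 (fun p : A => p@_U_(enum_rank u))) /eqP.
by rewrite /zvar mcoeffXU eqxx mcoeff0 oner_eq0.
Qed.

(** The degree argument with the scaling: a factor [h] of positive degree would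
    force all the [eigen_defect]s, and with them [M ord_max ord0], to
    vanish. *)
Lemma hess_squarefree h : (2 <= m)%N -> M ord_max ord0 != 0 ->
  h * h %|r M ord_max ord0 -> h \is a GRing.unit.
Proof.
move=> m2 f0 dvdf; have h0 : h != 0.
  by apply: contraNneq f0 => E; case: dvdf => q ->; rewrite E !mulr0.
set D := deform scaling.
suff sz1 : (size (D h) <= 1)%N.
  have E := scaling_const sz1; rewrite E; apply: mpolyC_unit.
  by apply: contraNneq h0 => E0; rewrite E E0 mpolyC0.
have inj_D p : D p = 0 -> p = 0.
  move=> E; have := @scaling_const p; rewrite -/D E size_poly0 => /(_ isT) Ep.
  by move: E; rewrite Ep /D deformC => /eqP; rewrite polyC_eq0 => /eqP.
have dvd_defect k := square_dvd_eigen_defect k f0 dvdf.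
rewrite leqNgt; apply/negP => gt1.
(* Some defect is not zero, and it has degree at most 2. *)
have sz2 : size (D h) = 2.
  have [k nk] : exists k, eigen_defect k != 0.
    apply: contrapT => nex; move/eqP: f0; apply.
    apply: eigen_defect0_hess; last exact: ltnW.
    by move=> k; apply/eqP; apply: contrapT => /negP nk; apply: nex; exists k.
  have k0 : k != ord0.
    apply: contraNneq nk => ->.
    by rewrite /eigen_defect unipotent_lt // eqxx mul1r subrr.
  have [q Eq] := dvd_defect k.
  have Dk0 : D (eigen_defect k) != 0 by apply: contraNneq nk => /inj_D ->.
  have EDk : D (eigen_defect k) = D q * (D h * D h) by rewrite Eq /D !rmorphM.
  apply/eqP; rewrite eqn_leq gt1 andbT.
  apply: (size_square_factor (d := 3) Dk0 EDk).
  exact: size_deform_scaling_defect.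
(* [t] is the linear part of [h]; the coefficients of degree 2 are compared. *)
set t := lead_coef (D h); have t0 : t != 0.
  by rewrite lead_coef_eq0 -size_poly_gt0 sz2.
have quot k : k != ord0 -> exists c, eigen_defect k = c%:MP * (h * h)
    /\ - (U k ord0 * linear_part ord0) = c%:MP * (t * t).
  move=> k0; have [q Eq] := dvd_defect k.
  have EDk : D (eigen_defect k) = D q * (D h * D h) by rewrite Eq /D !rmorphM.
  have [sq Ec] := square_factor_coef2 EDk (size_deform_scaling_defect k0) sz2.
  exists (q.@[fun=> 0]); split; first by rewrite Eq {1}(scaling_const sq).
  rewrite -coef2_deform_scaling_defect // Ec (scaling_const sq) /D deformC.
  by rewrite coefC mevalC.
(* Two rows besides row [0] are needed: this is where [n >= 3] enters. *)
have lt1 : (1 < n)%N by apply: ltnW.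
have lt2 : (2 < n)%N by [].
pose k1 := Ordinal lt1; pose k2 := Ordinal lt2.
have [c1 [_ E1]] := quot k1 isT; have [c2 [_ E2]] := quot k2 isT.
have lt01 : (@ord0 m < k1)%N by [].
have lt02 : (@ord0 m < k2)%N by [].
rewrite (unipotent_gt lt01) in E1; rewrite (unipotent_gt lt02) in E2.
have L0 : linear_part ord0 = 0.
  apply/eqP; apply: contraT => L0.
  have c10 : c1 = 0.
    apply: (@zvar_indep _ _ c1 c2 _ _); last first.
      apply: (mulIf (mulf_neq0 L0 (mulf_neq0 t0 t0))); exact: (cross_eq E1 E2).
    by [].
  move/eqP: E1; rewrite c10 mpolyC0 mul0r oppr_eq0 mulf_eq0 (negbTE L0) orbF.
  by rewrite (negbTE (zvar_neq0 _)).
move/eqP: f0; apply; apply: eigen_defect0_hess; last exact: ltnW.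
move=> k; have [->|k0] := eqVneq k ord0.
  by rewrite /eigen_defect unipotent_lt // eqxx mul1r subrr.
have [c [-> ]] := quot k k0; rewrite L0 mulr0 oppr0 => /esym/eqP.
by rewrite !mulf_eq0 (negbTE t0) !orbF => /eqP ->; rewrite mul0r.
Qed.

End Conjugate.
End Chart.

(** * Reducedness *)

Lemma conj_mulmx (A : comUnitRingType) k (G U X : 'M[A]_k) :
  G \in unitmx -> U \in unitmx ->
  invmx (G *m U) *m X *m (G *m U) = invmx U *m (invmx G *m X *m G) *m U.
Proof.
move=> UG UU; have UGU : G *m U \in unitmx by rewrite unitmx_mul UG.
suff -> : invmx (G *m U) = invmx U *m invmx G by rewrite !mulmxA.
by apply: (can_inj (mulKmx UGU)); rewrite mulmxV // mulmxA mulmxK // mulmxV.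
Qed.

Lemma hess_eqnE (C : fieldType) (m : nat) (x g : 'M[C]_m.+1) :
    let U := generic_unipotent C m.+1 in g \in unitmx ->
  hess_eqn x g
  = (invmx U *m map_mx (@mpolyC _ C) (invmx g *m x *m g) *m U) ord_max ord0.
Proof.
move=> U Ug; rewrite /hess_eqn /generic_rep.
set G := map_mx _ g; have UG : G \in unitmx by rewrite map_unitmx.
rewrite (conj_mulmx _ UG (unipotent_unit C m)).
by rewrite -(map_invmx (@mpolyC _ C)) -!map_mxM.
Qed.

Theorem hess_radical (C : fieldType) (m : nat) (x g : 'M[C]_m.+1) p k :
    (2 <= m)%N -> g \in unitmx ->
  hess_eqn x g %|r p ^+ k -> hess_eqn x g %|r p.
Proof.
move=> m2 Ug; have [f0 | f0] := eqVneq (hess_eqn x g) 0.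
  rewrite f0 => -[q]; rewrite mulr0 => /eqP; rewrite expf_eq0 => /andP[_ /eqP->].
  by exists 0; rewrite mul0r.
apply: prime_product_radical; first exact: factorial_mpoly.
move=> h [h0 Ph] dvdh; apply: (prime_ideal1 Ph).
rewrite (hess_eqnE x Ug) in f0 dvdh.
set M := invmx _ *m _ *m _ in f0 dvdh.
have UM : generic_unipotent C m.+1 *m M
    = map_mx (@mpolyC _ C) (invmx g *m x *m g) *m generic_unipotent C m.+1.
  by rewrite /M -mulmxA mulKVmx ?unipotent_unit.
by exists h^-1; rewrite mulVr // (hess_squarefree UM m2 f0 dvdh).
Qed.

Theorem theorem6 (R : realType) (m : nat) (hn : (3 <= m.+1)%N)
  (x : 'M[R[i]]_m.+1) : hess_scheme_reduced (C := R[i]) x.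
Proof.
move=> g Ug P primeP _ p s k _ [w [nPw]] /=.
rewrite mulr1 mul0r subr0 => -[q Eq].
(* The exponent is raised by one so that [k = 0] needs no separate case. *)
have [|r Er] := @hess_radical _ m x g (w * p) k.+1 hn Ug.
  by exists (w ^+ k * p * q); rewrite exprMn exprSr exprS -!mulrA -Eq; ring.
by exists w; split=> //=; exists r; rewrite mulr1 mul0r subr0.
Qed.
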